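(* Let $m$ be a positive odd integer and let $d$ be an integer. Then $$f^{(m)}_{md+2}(x)\in\begin{cases}\mathscr{P}^{(m-2)} & \text{if } d \text{ is even},\\ \mathscr{A}^{(m-2)} & \text{if } d\text{ is odd.}\end{cases}$$ Equivalently, when $md+2\ge 0$, $\tilde\beta_{md+2}(m,x)$ lies in $\mathscr{P}^{(m-2)}$ if $d$ is even and in $\mathscr{A}^{(m-2)}$ if $d$ is odd. Consequently, $\tilde\beta_{md+2}(m)=0$ whenever $d$ is odd (and $md+2\ge 0$).
   Context: For a positive integer $m$ let $\Psi_m(x)=\sum_{j=0}^{m-1}x^j$. The polynomial $1-x$ is invertible modulo $\Psi_m(x)$ over $\mathbb{Q}$; for $k\in\mathbb{Z}$ let $f_k^{(m)}(x)\in\mathbb{Q}[x]$ be the unique polynomial of degree less than $\deg\Psi_m=m-1$ (the zero polynomial if $m=1$) congruent to $(1-x)^{-k}$ modulo $\Psi_m(x)$. For $k\ge 0$ let $\tilde\beta_k(m,x)=(-1)^k k!\,f_k^{(m)}(x)$. The degenerate Bernoulli numbers $\beta_k(\lambda)$ ($\lambda\ne0$) are defined by $\frac{t}{(1+\lambda t)^{1/\lambda}-1}=\sum_{k\ge 0}\beta_k(\lambda)\frac{t^k}{k!}$, and $\tilde\beta_k(m)=m^k\beta_k(1/m)$; equivalently $\frac{m}{\Psi_m(x)}=\sum_{k\ge 0}\frac{(-1)^k}{k!}\tilde\beta_k(m)(1-x)^k$. For an integer $n$, $\mathscr{P}^{(n)}$ (palindromic polynomials of darga $n$) is the set of real polynomials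 $p(x)$ with $x^np(1/x)=p(x)$, and $\mathscr{A}^{(n)}$ (anti-palindromic polynomials of darga $n$) is the set of real polynomials $p(x)$ with $x^np(1/x)=-p(x)$; i.e. writing $\alpha_j$ for the coefficient of $x^j$ in $p$ (zero if $x^j$ does not occur), $\alpha_j=\alpha_{n-j}$, respectively $\alpha_j=-\alpha_{n-j}$, for all $j\in\mathbb{Z}$. The zero polynomial belongs to both. *)

(* Defs.v *)
From mathcomp Require Import all_boot all_order all_algebra.
From mathcomp Require Import zify ring.

Set Implicit Arguments.
Unset Strict Implicit.
Unset Printing Implicit Defensive.

Import Order.TTheory GRing.Theory Num.Theory.

Local Open Scope ring_scope.

Definition coefz (R : nzRingType) (p : {poly R}) (j : int) : R :=
  if j is Posz n then p`_n else 0.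

(* The darga n may be negative or smaller than the degree of p;
   palindromicP and antipalindromicP give the form x^n p(1/x) = ± p(x). *)
Definition palindromic (R : nzRingType) (n : int) (p : {poly R}) : Prop :=
  forall j : int, coefz p j = coefz p (n - j).

Definition antipalindromic (R : nzRingType) (n : int) (p : {poly R}) : Prop :=
  forall j : int, coefz p j = - coefz p (n - j).

Lemma poly_eq_nz (R : numDomainType) (p q : {poly R}) :
  (forall x, x != 0 -> p.[x] = q.[x]) -> p = q.
Proof.
move=> H; apply/eqP; rewrite -subr_eq0; apply/eqP.
pose s := [seq (i.+1)%:R : R | i <- iota 0 (size (p - q))].
apply: (@roots_geq_poly_eq0 _ _ s).
- apply/allP => x /mapP [i _ ->].
  by rewrite rootE hornerD hornerN H ?subrr // pnatr_eq0.
- rewrite map_inj_uniq ?iota_uniq // => i j /eqP.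
  by rewrite eqr_nat eqSS => /eqP.
- by rewrite size_map size_iota.
Qed.

Lemma darga_symP (R : numFieldType) (e : R) (n : int) (p : {poly R}) :
  (forall j, coefz p (n - j) = e * coefz p j) <->
  (forall x, x != 0 -> x ^ n * p.[x^-1] = e * p.[x]).
Proof.
pose N := size p; pose a := (N + absz n)%N.
pose Q := \sum_(i < N) p`_i *: 'X^(absz (a%:Z + n - i%:Z)%R) : {poly R}.
have EQ x : x != 0 -> Q.[x] = x ^+ a * (x ^ n * p.[x^-1]).
  move=> x0; rewrite (horner_coef p) horner_sum !mulr_sumr.
  apply: eq_bigr => i _; rewrite hornerZ hornerXn.
  have -> : x ^+ absz (a%:Z + n - i%:Z)%R = x ^ (a%:Z + n - i%:Z).
    by rewrite exprnP; congr (_ ^ _); have := ltn_ord i; lia.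
  rewrite !expfzDr // exprVn exprnN; rewrite -exprnP; ring.
have coefzN m : (N <= m)%N -> coefz p m = 0 by move=> ?; apply: nth_default.
have CQ k : Q`_k = coefz p (a%:Z + n - k%:Z).
  rewrite coef_sum.
  have [[i Ei]|neg] : (exists i : nat, a%:Z + n - k%:Z = i) \/
     (a%:Z + n - k%:Z < 0) by case: (a%:Z + n - k%:Z) => i; [left; exists i|right].
  - rewrite Ei; have [Ni|iN] := leqP N i.
      rewrite coefzN // big1 // => j _; rewrite coefZ coefXn.
      by case: eqP => [E|_]; rewrite ?mulr0 //; have := ltn_ord j; lia.
    rewrite (bigD1 (Ordinal iN)) //= coefZ coefXn big1 ?addr0.
      by case: eqP => [_|E]; rewrite ?mulr1 //; lia.
    move=> j /eqP ji; rewrite coefZ coefXn.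
    case: eqP => [E|_]; rewrite ?mulr0 //; case: ji; apply: val_inj => /=.
    by have := ltn_ord j; lia.
  - rewrite big1; first by move: neg; case: (_ - _).
    move=> j _; rewrite coefZ coefXn; case: eqP => [E|_]; rewrite ?mulr0 //.
    by have := ltn_ord j; lia.
have CX k : (e *: ('X^a * p))`_k = e * coefz p (k%:Z - a%:Z).
  rewrite coefZ coefXnM; case: ltnP => ka; first by have -> :
    k%:Z - a%:Z = Negz (a - k).-1 by lia.
  by have -> : k%:Z - a%:Z = (k - a)%N by lia.
have EX x : (e *: ('X^a * p)).[x] = x ^+ a * (e * p.[x]).
  by rewrite hornerZ hornerM hornerXn; ring.
split=> [H x x0|H j].
- apply: (mulfI (expf_neq0 a x0)); rewrite -EX -EQ //; congr (_.[_]).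
  apply/polyP => k; rewrite CX CQ -H; congr coefz; lia.
- have EE : Q = e *: ('X^a * p).
    by apply: poly_eq_nz => x x0; rewrite EX EQ // H.
  have [jneg|jpos] := ltrP j (- a%:Z).
    have -> : coefz p j = 0 by case: j jneg => //= k; lia.
    have -> : n - j = absz (n - j)%R by lia.
    by rewrite mulr0 coefzN //; lia.
  have [k kE] : exists k : nat, j = k%:Z - a%:Z.
    by exists (absz (j + a%:Z)%R); lia.
  rewrite {2}kE -CX -EE CQ; congr coefz; rewrite kE; lia.
Qed.

Lemma palindromicP (R : numFieldType) (n : int) (p : {poly R}) :
  palindromic n p <-> (forall x, x != 0 -> x ^ n * p.[x^-1] = p.[x]).
Proof.
split=> [H x x0|H j].
- rewrite -[RHS]mul1r; apply: (darga_symP 1 n p).1 => // j.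
  by rewrite mul1r -H.
- by rewrite ((darga_symP 1 n p).2 _ j) ?mul1r // => x x0; rewrite mul1r H.
Qed.

Lemma antipalindromicP (R : numFieldType) (n : int) (p : {poly R}) :
  antipalindromic n p <-> (forall x, x != 0 -> x ^ n * p.[x^-1] = - p.[x]).
Proof.
split=> [H x x0|H j].
- rewrite -mulN1r; apply: (darga_symP (-1) n p).1 => // j.
  by rewrite mulN1r [in RHS]H opprK.
- rewrite ((darga_symP (-1) n p).2 _ j) ?mulN1r ?opprK // => x x0.
  by rewrite mulN1r H.
Qed.

Definition Psi (m : nat) : {poly rat} := \sum_(j < m) 'X^j.

(* The inverse of p modulo q when p and q are coprime: the leading coefficient
   is that of the constant Bezout combination. *)
Definition polyinv_mod (F : fieldType) (p q : {poly F}) : {poly F} :=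
  let e := egcdp p q in (lead_coef (e.1 * p + e.2 * q))^-1 *: e.1 %% q.

(* The representative of (1 - x)^(-k) of degree < m - 1; meaningful for m > 0,
   see fpolyP. *)
Definition fpoly (m : nat) (k : int) : {poly rat} :=
  match k with
  | Posz n => (polyinv_mod (1 - 'X) (Psi m) ^+ n) %% Psi m
  | Negz n => ((1 - 'X) ^+ n.+1) %% Psi m
  end.

Lemma PsiE m : Psi m = \poly_(j < m) 1.
Proof. by rewrite poly_def; apply: eq_bigr => j _; rewrite scale1r. Qed.

Lemma size_Psi m : size (Psi m) = m.
Proof.
by case: m => [|m]; rewrite PsiE ?size_poly_eq ?oner_eq0 // poly_def big_ord0 size_poly0.
Qed.

Lemma Psi_neq0 m : (0 < m)%N -> Psi m != 0.
Proof. by rewrite -size_poly_eq0 size_Psi; case: m. Qed.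

Lemma coprimep_Psi m : (0 < m)%N -> coprimep (1 - 'X) (Psi m).
Proof.
move=> m0; rewrite coprimep_sym -opprB -scaleN1r coprimepZr ?oppr_eq0 ?oner_eq0 //.
rewrite -polyC1 coprimep_XsubC rootE horner_sum.
under eq_bigr do rewrite hornerXn expr1n.
by rewrite sumr_const card_ord pnatr_eq0; case: m m0.
Qed.

Lemma polyinv_modP (F : fieldType) (p q : {poly F}) :
  coprimep p q -> (polyinv_mod p q * p) %% q = 1 %% q.
Proof.
move=> co; rewrite /polyinv_mod; set e := egcdp p q.
have /size_poly1P[c c0 E] : size (e.1 * p + e.2 * q) == 1%N.
  by rewrite -(eqp_size (egcdpE p q)).
rewrite E lead_coefC mulrC modp_mul.
have -> : p * (c^-1 *: e.1) = 1 - (c^-1 *: e.2) * q.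
  rewrite -scalerAr mulrC -scalerAl; apply/eqP; rewrite eq_sym subr_eq; apply/eqP.
  by rewrite -scalerDr E -mul_polyC -polyCM mulVf.
by rewrite modpD modpN modp_mull subr0.
Qed.

Lemma fpolyP (m : nat) (k : int) (f : {poly rat}) : (0 < m)%N ->
  f = fpoly m k <->
  (size f < m)%N /\
  match k with
  | Posz n => (f * (1 - 'X) ^+ n) %% Psi m = 1 %% Psi m
  | Negz n => f %% Psi m = ((1 - 'X) ^+ n.+1) %% Psi m
  end.
Proof.
move=> m0; have P0 := Psi_neq0 m0; have sM (g : {poly rat}) : (size (g %% Psi m)%R < m)%N.
  by rewrite -{2}(size_Psi m) ltn_modp.
have small (g : {poly rat}) : (size g < m)%N -> g %% Psi m = g.
  by move=> sg; rewrite modp_small // size_Psi.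
set u := polyinv_mod (1 - 'X) (Psi m).
have modX (g h : {poly rat}) n : g %% Psi m = h %% Psi m ->
    (g ^+ n) %% Psi m = (h ^+ n) %% Psi m.
  move=> gh; elim: n => // n IH.
  by rewrite !exprS -modp_mul IH modp_mul mulrC -modp_mul gh modp_mul mulrC.
have uX n : (u ^+ n * (1 - 'X) ^+ n) %% Psi m = 1 %% Psi m.
  by rewrite -exprMn -[1 in RHS](expr1n _ n); apply/modX/polyinv_modP/coprimep_Psi.
case: k => n; split=> [->|[sf E]] /=; rewrite -/u.
- by split; rewrite // mulrC modp_mul mulrC uX.
- rewrite -(small f sf) -[f]mulr1 -modp_mul -(uX n) modp_mul.
  by rewrite (mulrC (u ^+ n)) mulrA mulrC -modp_mul E modp_mul mulr1.
- by split=> [|]; [exact: sM|rewrite small].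
- by rewrite -(small f sf).
Qed.

(* Formal power series are represented by their coefficient sequences. *)
Definition fps_mul (F : nzRingType) (a b : nat -> F) (n : nat) : F :=
  \sum_(i < n.+1) a i * b (n - i)%N.

(* The first n coefficients of the power series 1 / a. *)
Fixpoint fps_inv_seq (F : fieldType) (a : nat -> F) (n : nat) : seq F :=
  if n is n'.+1 then
    let s := fps_inv_seq a n' in
    rcons s ((a 0%N)^-1 * ((n' == 0%N)%:R - \sum_(i < n') a (n' - i)%N * s`_i))
  else [::].

Definition fps_inv (F : fieldType) (a : nat -> F) (n : nat) : F :=
  (fps_inv_seq a n.+1)`_n.

(* Coefficients of (1 + lambda t)^(1/lambda), by the binomial series. *)
Definition degexp (F : fieldType) (lambda : F) (j : nat) : F :=
  (\prod_(i < j) (lambda^-1 - i%:R)) / j`!%:R * lambda ^+ j.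

(* The factor t of t / ((1 + lambda t)^(1/lambda) - 1) is cancelled by
   dropping the constant term of the exponential series; see
   degbernoulli_gen for the generating function itself. *)
Definition degbernoulli (F : fieldType) (lambda : F) (k : nat) : F :=
  k`!%:R * fps_inv (fun j => degexp lambda j.+1) k.

(* beta~_k(m), and beta~_k(m, x) in betat_poly. *)
Definition betat (F : fieldType) (m k : nat) : F :=
  m%:R ^+ k * degbernoulli (m%:R^-1) k.

Definition betat_poly (m k : nat) : {poly rat} :=
  ((-1) ^+ k * k`!%:R) *: fpoly m k%:Z.

Lemma size_fps_inv_seq (F : fieldType) (a : nat -> F) n :
  size (fps_inv_seq a n) = n.
Proof. by elim: n => //= n IH; rewrite size_rcons IH. Qed.

Lemma nth_fps_inv_seq (F : fieldType) (a : nat -> F) n i :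
  (i < n)%N -> (fps_inv_seq a n)`_i = fps_inv a i.
Proof.
elim: n => // n IH; rewrite ltnS leq_eqVlt => /predU1P[-> //|iltn].
by rewrite -IH //= nth_rcons size_fps_inv_seq iltn.
Qed.

Lemma fps_mul_inv (F : fieldType) (a : nat -> F) n :
  a 0%N != 0 -> fps_mul a (fps_inv a) n = (n == 0%N)%:R.
Proof.
move=> a0; rewrite /fps_mul (reindex_inj rev_ord_inj) big_ord_recr /=.
rewrite subnn subn0 {2}/fps_inv /= nth_rcons size_fps_inv_seq ltnn eqxx.
rewrite mulrA divff // mul1r.
under eq_bigr => i _.
  rewrite subSS (subKn (ltnW (ltn_ord i))) -(nth_fps_inv_seq _ (ltn_ord i)).
  over.
by rewrite addrC subrK.
Qed.

(* t = ((1 + lambda t)^(1/lambda) - 1) * sum_k beta_k(lambda) t^k / k! *)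
Lemma degbernoulli_gen (F : numFieldType) (lambda : F) : lambda != 0 ->
  fps_mul (fun j => degexp lambda j - (j == 0%N)%:R)
          (fun k => degbernoulli lambda k / k`!%:R)
  =1 (fun n => (n == 1%N)%:R).
Proof.
move=> l0 n.
have b k : degbernoulli lambda k / k`!%:R =
    fps_inv (fun j => degexp lambda j.+1) k.
  by rewrite /degbernoulli mulrC mulKf // pnatr_eq0 -lt0n fact_gt0.
rewrite /fps_mul big_ord_recl /= {1}/degexp big_ord0 expr0 fact0 divr1 mulr1.
rewrite subrr mul0r add0r.
case: n => [|n]; first by rewrite big_ord0.
rewrite eqSS -(fps_mul_inv (a := fun j => degexp lambda j.+1)).
  by apply: eq_bigr => i _; rewrite /= subr0 subSS b.
by rewrite /degexp big_ord1 subr0 divr1 mulVf ?oner_eq0.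
Qed.

Lemma degbernoulli_uniq (F : numFieldType) (lambda : F) (beta : nat -> F) :
  lambda != 0 ->
  fps_mul (fun j => degexp lambda j - (j == 0%N)%:R)
          (fun k => beta k / k`!%:R)
  =1 (fun n => (n == 1%N)%:R) ->
  beta =1 degbernoulli lambda.
Proof.
move=> l0 H n; elim/ltn_ind: n => n IH.
have := H n.+1; rewrite -(degbernoulli_gen l0) /fps_mul.
rewrite !(big_ord_recl n.+1) !(big_ord_recl n) /= !subSS !subn0.
have -> : degexp lambda 0 - true%:R = 0.
  by rewrite /degexp big_ord0 expr0 fact0 divr1 mulr1 subrr.
rewrite !mul0r !add0r.
under eq_bigr => i _.
  rewrite /bump /= !add1n subSS IH; last first.
    by rewrite ltn_subrL /=; case: n i {IH} => [[]|].
  over.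
under [in RHS]eq_bigr => i _ do rewrite /bump /= !add1n subSS.
move=> /addIr /eqP; rewrite -subr_eq0 -mulrBr -mulrBl subr0 !mulf_eq0 subr_eq0.
by rewrite big_ord1 subr0 /= !invr_eq0 !pnatr_eq0 expf_eq0 (negPf l0) eqn0Ngt
  fact_gt0 /= [X in _ || X]eqn0Ngt fact_gt0 orbF => /eqP.
Qed.

(* Main.v *)
Require Import Defs.
From mathcomp Require Import all_boot all_order all_algebra.
From mathcomp Require Import all_field.
From mathcomp Require Import zify ring.
From mathcomp Require Import reals.

Set Implicit Arguments.
Unset Strict Implicit.
Unset Printing Implicit Defensive.

Import Order.TTheory GRing.Theory Num.Theory.

Local Open Scope ring_scope.

(* Palindromicity is checked at the m-th roots of unity z <> 1. There
   f_k(z) = (1 - z)^(-k), and 1 - 1/z = - (1 - z) / z, so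
   z^(m-2) f_k(1/z) = (-1)^k z^(k+m-2) f_k(z) = (-1)^k f_k(z) when m divides
   k - 2. Both z^(m-2) f_k(1/z) and f_k have degree at most m - 2, and there are
   m - 1 such z, so the identity holds between polynomials.

   Moreover beta~_k(m) = beta~_k(m, 1), and an anti-palindromic polynomial
   vanishes at 1. Indeed (1 - x)^k f_k = 1 - q Psi_m with deg q < k, so the
   coefficient of (1 - x)^k in 1 / Psi_m is f_k(1) / Psi_m(1) = f_k(1) / m. *)

Lemma horner_map_Psi (L : numFieldType) (m : nat) (z : L) :
  (map_poly ratr (Psi m)).[z] = \sum_(j < m) z ^+ j.
Proof.
rewrite /Psi rmorph_sum horner_sum; apply: eq_bigr => j _.
by rewrite rmorphXn /= map_polyX hornerXn.
Qed.

Lemma root_map_Psi (L : numFieldType) (m : nat) (z : L) :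
  z ^+ m = 1 -> z != 1 -> (map_poly ratr (Psi m)).[z] = 0.
Proof.
move=> zm z1; rewrite horner_map_Psi; apply/eqP.
by rewrite -(mulrI_eq0 _ (lregP (x := z - 1) _)) ?subr_eq0 // -subrX1 zm subrr.
Qed.

(** Such a [z] is a root of [Psi m], so evaluation at [z] factors through the quotient by
    [Psi m]. *)
Lemma eq_modp_Psi_horner (L : numFieldType) (m : nat) (p q : {poly rat}) (z : L) :
  z ^+ m = 1 -> z != 1 -> p %% Psi m = q %% Psi m ->
  (map_poly ratr p).[z] = (map_poly ratr q).[z].
Proof.
move=> zm z1 pq; rewrite (divp_eq p (Psi m)) (divp_eq q (Psi m)) pq.
by rewrite !rmorphD !rmorphM !hornerD !hornerM root_map_Psi // !mulr0.
Qed.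

Lemma fpoly_horner (L : numFieldType) (m : nat) (k : int) (z : L) :
  (0 < m)%N -> z ^+ m = 1 -> z != 1 ->
  (map_poly ratr (fpoly m k)).[z] = (1 - z) ^ (- k).
Proof.
move=> m0 zm z1; have z1' : 1 - z != 0 by rewrite subr_eq0 eq_sym.
have y_z n : (map_poly ratr ((1 - 'X) ^+ n)).[z] = (1 - z) ^+ n :> L.
  by rewrite rmorphXn rmorphB rmorph1 /= map_polyX horner_exp hornerD hornerN hornerX hornerC.
have [_] := (fpolyP k (fpoly m k) m0).1 erefl.
case: k => n /(eq_modp_Psi_horner zm z1); last by rewrite y_z NegzE opprK.
rewrite rmorphM hornerM y_z rmorph1 hornerC => E.
by apply: (mulIf (expf_neq0 n z1')); rewrite E -exprnN mulVf ?expf_neq0.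
Qed.

Lemma fpoly_darga (m : nat) (k : int) : (0 < m)%N -> (m %| k - 2)%Z ->
  forall j, coefz (fpoly m k) (m%:Z - 2 - j) = (-1) ^ k * coefz (fpoly m k) j.
Proof.
move=> m0 /dvdzP[c kE]; set f := fpoly m k.
have [sf _] := (fpolyP k f m0).1 erefl.
(* [g] is the reversal x^(m-2) f(1/x); both [g] and [f] vanish when m = 1. *)
pose g := \poly_(i < m.-1) f`_(m.-2 - i).
have sf' : (size f <= m.-1)%N by rewrite -ltnS prednK.
have gf : g = (-1) ^ k *: f.
  have [w wP] := C_prim_root_exists m0.
  have w1 i : (i < m.-1)%N -> w ^+ i.+1 != 1.
    by move=> im; rewrite -(prim_order_dvd wP) gtnNdvd //; lia.
  suff /eqP : map_poly (ratr : rat -> algC) (g - (-1) ^ k *: f) = 0.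
    by rewrite map_poly_eq0 subr_eq0 => /eqP.
  apply: (@roots_geq_poly_eq0 _ _ [seq w ^+ i.+1 | i <- iota 0 m.-1]).
  - apply/allP=> z /mapP[i]; rewrite mem_iota add0n => /andP[_ im] zE.
    have z1 : z != 1 by rewrite zE w1.
    have zm : z ^+ m = 1 by rewrite zE exprAC (prim_expr_order wP) expr1n.
    have z0 : z != 0 by apply: contraNneq (oner_neq0 algC) => z0; rewrite -zm z0 expr0n; case: (m) m0.
    rewrite rootE rmorphB /= hornerD hornerN subr_eq0 map_polyZ hornerZ.
    rewrite fmorphXz rmorphN1 fpoly_horner //.
    have -> : (map_poly ratr g).[z] = z ^+ m.-2 * (map_poly ratr f).[z^-1].
      rewrite (@horner_coef_wide _ m.-1) ?size_map_poly ?size_poly //.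
      rewrite (@horner_coef_wide _ m.-1) ?size_map_poly //.
      rewrite mulr_sumr (reindex_inj rev_ord_inj) /=; apply: eq_bigr => j _.
      rewrite !coef_map coef_poly /=; have jm := ltn_ord j.
      have -> : (m.-1 - j.+1 < m.-1)%N by lia.
      have -> : (m.-2 - (m.-1 - j.+1) = j)%N by lia.
      rewrite mulrCA; congr (_ * _); rewrite exprVn -expfB_cond; last by rewrite (negPf z0); lia.
      by congr (_ ^+ _); lia.
    rewrite fpoly_horner // ?exprVn ?zm ?invr1 //; last by rewrite invr_eq1.
    have -> : 1 - z^-1 = -1 * (1 - z) * z^-1 by field.
    have zk : z ^ (k - 2) = 1 by rewrite kE mulrC -exprz_exp -exprnP zm exp1rz.
    rewrite !expfzMl exprz_inv opprK mulrC -!mulrA.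
    (* This is z^(k-2) z^m. The bound [i < m.-1] forces m >= 2, so [m.-2] is the true m - 2. *)
    have -> : z ^ k * z ^+ m.-2 = 1.
      have -> : k = (k - 2) + 2 by lia.
      by rewrite expfzDr // zk mul1r -exprnP -exprD -zm; congr (_ ^+ _); lia.
    by rewrite mulr1 -[in (-1) ^ (- k)]exprz_inv invrN invr1.
  - rewrite map_inj_in_uniq ?iota_uniq // => i j.
    rewrite !mem_iota !add0n => /andP[_ im] /andP[_ jm] /eqP.
    by rewrite (eq_prim_root_expr wP) !modn_small; lia.
  - rewrite size_map size_iota size_map_poly.
    rewrite (leq_trans (size_polyD _ _)) // geq_max size_poly size_polyN.
    by rewrite (leq_trans (size_scale_leq _ _)).
(* [gf] settles 0 <= j <= m - 2. For any other j, both j and m - 2 - j lie outside this range, where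
   the coefficients of [f] vanish. *)
have fN n : (m.-1 <= n)%N -> f`_n = 0.
  by move=> mn; rewrite nth_default // (leq_trans sf').
move=> j; have [j0|j0] := ltrP j 0.
  have -> : coefz f j = 0 by case: j j0.
  have -> : m%:Z - 2 - j = absz (m%:Z - 2 - j)%R by lia.
  by rewrite mulr0 /= fN //; lia.
have -> : j = absz j by lia.
have [jm|jm] := leqP m.-1 (absz j).
  have : m%:Z - 2 - (absz j)%:Z < 0 by lia.
  by rewrite /= fN // mulr0; case: (_ - _).
have -> : m%:Z - 2 - (absz j)%:Z = (m.-2 - absz j)%N by lia.
by rewrite /= -coefZ -gf coef_poly jm.
Qed.

(** For lambda = 1/m the series is the polynomial (1 + t/m)^m, and the product in [degexp] is a
    falling factorial. *)
Lemma degexp_inv_nat (F : numFieldType) (m j : nat) :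
  degexp (m%:R^-1 : F) j = 'C(m, j)%:R / m%:R ^+ j.
Proof.
rewrite /degexp invrK exprVn; congr (_ / _).
have -> : \prod_(i < j) (m%:R - i%:R) = (m ^_ j)%:R :> F.
  elim: j => [|j IH]; first by rewrite big_ord0.
  rewrite big_ord_recr /= IH ffactnSr natrM.
  by have [jm|mj] := leqP j m; [rewrite natrB | rewrite ffact_small // !mul0r].
by rewrite -bin_ffact natrM mulfK // pnatr_eq0 -lt0n fact_gt0.
Qed.

(** Psi_m(1 + s) = ((1 + s)^m - 1) / s. *)
Lemma coef_Psi_shift (m j : nat) : (Psi m \Po ('X + 1))`_j = 'C(m, j.+1)%:R.
Proof.
have E : (Psi m \Po ('X + 1)) * 'X = ('X + 1) ^+ m - 1.
  have := subrX1 ('X : {poly rat}) m.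
  move/(congr1 (fun p => p \Po ('X + 1))).
  by rewrite rmorphM !rmorphB /= rmorphXn /= comp_polyX rmorph1 addrK mulrC => ->.
have -> : (Psi m \Po ('X + 1))`_j = ((Psi m \Po ('X + 1)) * 'X)`_j.+1 by rewrite coefMX.
rewrite E coefB coef1 subr0 exprDn coef_sum.
under eq_bigr do rewrite expr1n mulr1 coefMn coefXn.
have [jm|mj] := ltnP j m; last first.
  rewrite bin_small // big1 // => i _; case: eqP => [jE|]; last by rewrite mul0rn.
  by have := ltn_ord i; lia.
have im : (m - j.+1 < m.+1)%N by lia.
rewrite (bigD1 (Ordinal im)) //= subKn // eqxx bin_sub // big1 ?addr0 // => i ni.
case: eqP => [E1|]; last by rewrite mul0rn.
by case/eqP: ni; apply: val_inj => /=; have := ltn_ord i; lia.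
Qed.

(** The condition [0 < k] excludes m = 1, k = 0, where the left side is 1 but [fpoly] is zero. *)
Lemma betat_horner1 (F : numFieldType) (m k : nat) : (0 < m)%N -> (0 < k)%N ->
  betat F m k = ratr (betat_poly m k).[1].
Proof.
move=> m0 k0; set f := fpoly m k.
have [sf fE] := (fpolyP k f m0).1 erefl.
have mF : m%:R != 0 :> F by rewrite pnatr_eq0 -lt0n.
pose q := (1 - f * (1 - 'X) ^+ k) %/ Psi m.
have qE : q * Psi m = 1 - f * (1 - 'X) ^+ k.
  by rewrite divpK // /dvdp modpD modpN fE subrr.
(* f (1 - x)^k has degree at most k + m - 2, and dividing by [Psi m] lowers the degree by m - 1. *)
have sq : (size q <= k)%N.
  have : (size (1 - f * (1 - 'X) ^+ k)%R <= k + m.-1)%N.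
    rewrite (leq_trans (size_polyD _ _)) // geq_max size_poly1 size_polyN.
    apply/andP; split; first lia.
    rewrite (leq_trans (size_polyMleq _ _)) //.
    have syk : (size ((1 - 'X) ^+ k : {poly rat})%R <= k.+1)%N.
      rewrite (leq_trans (size_poly_exp_leq _ _)) //.
      by rewrite -opprB size_polyN -polyC1 size_XsubC mul1n.
    have le_add a b : (a < m)%N -> (b <= k.+1)%N -> ((a + b).-1 <= k + m.-1)%N by lia.
    exact: le_add.
  by rewrite /q size_divp ?Psi_neq0 // size_Psi leq_subLR addnC.
(* The substitution x = 1 + s turns (1 - x)^k into (-s)^k and evaluation at x = 1 into the constant
   coefficient. *)
pose sh (p : {poly rat}) : {poly F} := map_poly ratr (p \Po ('X + 1)).
have shE : sh q * sh (Psi m) = 1 - (-1) ^+ k *: (sh f * 'X^k).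
  have y_sh : (1 - 'X) \Po ('X + 1) = - 'X :> {poly rat}.
    by rewrite rmorphB rmorph1 /= comp_polyX opprD addrCA subrr addr0.
  rewrite /sh -rmorphM /= -comp_polyM qE comp_polyB comp_polyM comp_polyC.
  rewrite [(1 - 'X) ^+ k \Po _]rmorphXn /= y_sh [(- 'X) ^+ k]exprNn.
  rewrite rmorphB rmorph1 !rmorphM /= rmorph_sign map_polyXn mulrCA.
  by rewrite -[(-1) ^+ k](rmorph_sign polyC) mul_polyC.
have shq : (sh q)`_k = 0.
  rewrite nth_default // size_map_poly size_comp_poly2 //.
  by rewrite -[1]opprK -polyC1 -polyCN size_XsubC.
(* [b i] is beta_i(1/m) / i!, so the number beta~_i(m) is i! m^i [b i]. *)
pose b := fps_inv (fun j => degexp (m%:R^-1 : F) j.+1).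
have a0 : degexp (m%:R^-1 : F) 1 = 1 by rewrite degexp_inv_nat bin1 expr1 divff.
(* W is the expansion of m / Psi_m(1 + s) in powers of s, up to order k. *)
pose W := \poly_(i < k.+1) (m%:R ^+ i * b i).
have PW i : (i <= k)%N -> (sh (Psi m) * W)`_i = m%:R * (i == 0%N)%:R.
  (* The rescaling t = m s turns the inverse series in t into one in s; the factor t dropped from
     [degexp] accounts for the extra power of m. *)
  move=> ik; transitivity (m%:R ^+ i.+1 * (i == 0%N)%:R : F); last by case: (i) => [|n]; rewrite ?mulr0 ?expr1.
  rewrite -(fps_mul_inv (a := fun j => degexp (m%:R^-1 : F) j.+1)) ?a0 ?oner_eq0 //.
  rewrite coefM /fps_mul mulr_sumr; apply: eq_bigr => j _; have ji := ltn_ord j.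
  rewrite coef_map /= coef_Psi_shift ratr_nat coef_poly ifT; last by lia.
  rewrite degexp_inv_nat -/b.
  have -> : m%:R ^+ i.+1 = m%:R ^+ j.+1 * m%:R ^+ (i - j) :> F.
    by rewrite -exprD; congr (_ ^+ _); lia.
  by field; rewrite expf_neq0.
have Wk : W`_k = (-1) ^+ k * ratr f.[1].
  have : (W * (sh q * sh (Psi m)))`_k = 0.
    rewrite mulrCA mulrC (mulrC W) coefM big1 // => i _.
    have ik : (i <= k)%N by rewrite -ltnS ltn_ord.
    rewrite PW //; case: eqP => [->|_]; last by rewrite mulr0 mul0r.
    by rewrite subn0 shq mulr0.
  rewrite shE mulrBr mulr1 -scalerAr mulrA coefB coefZ coefMXn ltnn subnn coef0M.
  move/eqP; rewrite subr_eq0 => /eqP ->.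
  have -> : W`_0 = 1.
    rewrite coef_poly expr0 mul1r.
    have := fps_mul_inv (a := fun j => degexp (m%:R^-1 : F) j.+1) 0.
    by rewrite /fps_mul big_ord1 /= a0 mul1r subn0; apply; rewrite oner_eq0.
  by rewrite mul1r coef_map /= -horner_coef0 horner_comp hornerD hornerX hornerC add0r.
have bk : m%:R ^+ k * b k = (-1) ^+ k * ratr f.[1] by rewrite -Wk coef_poly ltnSn.
rewrite /betat /degbernoulli mulrCA -/b bk /betat_poly hornerZ !rmorphM /=.
by rewrite rmorphXn rmorphN1 ratr_nat; ring.
Qed.

Lemma coefz_map (R S : nzRingType) (f : {rmorphism R -> S}) (p : {poly R}) (j : int) :
  coefz (map_poly f p) j = f (coefz p j).
Proof. by case: j => n /=; rewrite ?coef_map ?rmorph0. Qed.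

Lemma coefzZ (R : nzRingType) (c : R) (p : {poly R}) (j : int) :
  coefz (c *: p) j = c * coefz p j.
Proof. by case: j => n /=; rewrite ?coefZ ?mulr0. Qed.

Theorem theorem6p2 (R : realType) (m : nat) (d : int) : odd m ->
  [/\ (2 %| d)%Z ->
        palindromic (m%:Z - 2) (map_poly (ratr : rat -> R) (fpoly m (m%:Z * d + 2))),
      ~~ (2 %| d)%Z ->
        antipalindromic (m%:Z - 2) (map_poly (ratr : rat -> R) (fpoly m (m%:Z * d + 2)))
    & forall k : nat, k%:Z = m%:Z * d + 2 ->
      [/\ (2 %| d)%Z ->
            palindromic (m%:Z - 2) (map_poly (ratr : rat -> R) (betat_poly m k)),
          ~~ (2 %| d)%Z ->
            antipalindromic (m%:Z - 2) (map_poly (ratr : rat -> R) (betat_poly m k))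
        & ~~ (2 %| d)%Z -> betat R m k = 0]].
Proof.
move=> m_odd; have m0 : (0 < m)%N by apply: odd_gt0.
set k := m%:Z * d + 2; set e : rat := (-1) ^ k.
(* As m is odd, k = m d + 2 has the parity of d, which fixes the sign (-1)^k. *)
have [c kE] : exists c, k = 2 * c + (~~ (2 %| d)%Z)%:Z.
  have mE : m%:Z = 2 * (m./2)%:Z + 1 by lia.
  have [/dvdzP[c dE]|d2] := boolP (2 %| d)%Z.
    by exists (m%:Z * c + 1); rewrite /k dE /=; lia.
  have [c dE] : exists c, d = 2 * c + 1 by exists (d %/ 2)%Z; lia.
  by exists (m%:Z * c + (m./2)%:Z + 1); rewrite /k dE /= mulrDr mulr1 {2}mE; ring.
have eE : e = if (2 %| d)%Z then 1 else -1.
  rewrite /e kE expfzDr // -exprz_exp (_ : (-1) ^ 2 = 1) // exp1rz mul1r.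
  by case: (2 %| d)%Z.
have fE j : coefz (fpoly m k) (m%:Z - 2 - j) = e * coefz (fpoly m k) j.
  by apply: fpoly_darga; rewrite // addrK dvdz_mulr.
(* The scalar [a] treats [fpoly] (a = 1) and its multiple [betat_poly] together. *)
have darga (a : rat) j :
    let p := map_poly (ratr : rat -> R) (a *: fpoly m k) in
    coefz p (m%:Z - 2 - j) = ratr e * coefz p j.
  by rewrite /= !coefz_map !coefzZ fE -rmorphM; congr (_ _); ring.
have pal a : (2 %| d)%Z ->
    palindromic (m%:Z - 2) (map_poly (ratr : rat -> R) (a *: fpoly m k)).
  by move=> d2 j; rewrite darga eE d2 rmorph1 mul1r.
have antipal a : ~~ (2 %| d)%Z ->
    antipalindromic (m%:Z - 2) (map_poly (ratr : rat -> R) (a *: fpoly m k)).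
  by move=> /negPf d2 j; rewrite darga eE d2 rmorphN1 mulN1r opprK.
have pal1 := pal 1; have antipal1 := antipal 1.
rewrite !scale1r in pal1 antipal1.
split=> // n nk; rewrite /betat_poly nk; split=> [d2|d2|d2]; [exact: pal|exact: antipal|].
(* For odd d the index is odd, hence nonzero. *)
have n0 : (0 < n)%N by move: kE; rewrite -/k -nk d2; lia.
rewrite betat_horner1 // /betat_poly nk; set p := _ *: _.
have : (map_poly (ratr : rat -> R) p).[1] = - (map_poly ratr p).[1].
  rewrite -(antipalindromicP (m%:Z - 2) _).1 ?oner_neq0 //; last exact: antipal.
  by rewrite exp1rz mul1r invr1.
move/eqP; rewrite eq_sym eqNr -[1](rmorph1 (ratr : rat -> R)) horner_map.
by move/eqP.
Qed.
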